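(* Let $K$ be a compact metric space, let $(f_n)$ be a pointwise converging sequence of continuous real-valued functions on $K$, let $\epsilon>0$, and let $\alpha$ be a countable ordinal. If $\mathcal O^{\alpha}(\epsilon,(f_n),K)\neq\emptyset$, then for every $\epsilon'$ with $0<\epsilon'<\epsilon$, $$\ell\left([f_n],\epsilon'/2\right)\ge \alpha/2 .$$ Moreover, there is an $\ell^1$-index tree on $(f_n)$ with index $\alpha/2$.
   Context: **Oscillation sets.** For a Polish space $K$, a pointwise convergent sequence $(f_n)$ of continuous real-valued functions on $K$ and $\epsilon>0$, put $A^+_{n,m}=\{k\in K: f_n(k)-f_m(k)>\epsilon\}$ and $A^-_{n,m}=\{k\in K: f_n(k)-f_m(k)<-\epsilon\}$. Let $\mathcal O^0(\epsilon,(f_n),K)=K$. Let $\mathcal O^{\alpha+1}(\epsilon,(f_n),K)$ be the set of $k\in\mathcal O^{\alpha}(\epsilon,(f_n),K)$ such that for every neighborhood $\mathcal N$ of $k$ there is $N\in\mathbb N$ such that for all $n\ge N$ there is $M\in\mathbb N$ with $\bigcap_{m\ge M}A^+_{n,m}\cap\mathcal O^\alpha(\epsilon,(f_n),K)\cap\mathcal N\ne\emptyset$ or $\bigcap_{m\ge M}A^-_{n,m}\cap\mathcal O^\alpha(\epsilon,(f_n),K)\cap\mathcal N\ne\emptyset$. For a limit ordinal $\beta$, $\mathcal O^\beta(\epsilon,(f_n),K)=\bigcap_{\alpha<\beta}\mathcal O^\alpha(\epsilon,(f_n),K)$. **Trees.** A tree (with finite nodes) on a set $S$ is a subset $\mathcal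 T$ of $\bigcup_{n\ge1}S^n$ closed under taking nonempty initial segments. Put $\mathcal T^0=\mathcal T$; $\mathcal T^{\alpha+1}$ is the set of $(x_1,\dots,x_n)\in\mathcal T^\alpha$ for which there is $x\in S$ with $(x_1,\dots,x_n,x)\in\mathcal T^\alpha$; $\mathcal T^\alpha=\bigcap_{\beta<\alpha}\mathcal T^\beta$ for limit $\alpha$. The order (index) $o(\mathcal T)$ is the least $\gamma$ with $\mathcal T^\gamma=\emptyset$. **$\ell^1$-index.** For a Banach space $X$ and $\delta>0$, $\mathcal T(X,\delta)$ is the tree of all $(x_1,\dots,x_n)$, $n\ge1$, with $x_j\in X$, $\|x_j\|\le1$ and $\|\sum_j\lambda_jx_j\|\ge\delta\sum_j|\lambda_j|$ for all $(\lambda_j)\in\mathbb R^n$. Then $\ell(X,\delta)=o(\mathcal T(X,\delta))$, with $\ell(X,\delta)=\omega_1$ if $\mathcal T(X,\delta)^\alpha\ne\emptyset$ for all countable $\alpha$. An $\ell^1$-index tree on $(f_n)$ is a tree of this kind (a subtree of some $\mathcal T([f_n],\delta)$) whose nodes have all their entries among the $f_n$; the theorem as stated does not name the constant $\delta$ for this tree. **Notation.** $[f_n]$ is the closed linear span of $(f_n)$ in $C(K)$. For an ordinal $\alpha=\omega^\gamma k+\beta$ with $\beta<\omega^\gamma$ and $k\in\mathbb N$, $\alpha/2$ denotes $\omega^\gamma[(k+1)/2]$, where $[\,\cdot\,]$ is the greatest integer function.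
   Formalization: The formal theorem adds that every f_n has sup norm at most 1; without it the claim fails, e.g. for f_n equal to 4 times the indicator of {1/n} on {0} ∪ {1/n}, with ε = 3, ε' = 5/2 and α = 1. *)

(* Defs.v *)
From HB Require Import structures.
From mathcomp Require Import all_boot all_order all_algebra.
From mathcomp Require Import all_classical all_reals all_analysis.

Set Implicit Arguments.
Unset Strict Implicit.
Unset Printing Implicit Defensive.

Import Order.TTheory GRing.Theory Num.Theory.
Import numFieldNormedType.Exports.

Local Open Scope classical_set_scope.
Local Open Scope ring_scope.

(** Countable ordinals as notations: [osup f] denotes the supremum of the
    ordinals [f n], for an arbitrary sequence [f]. Every countable ordinal has
    such a notation, see [ord_rank].
    Notations are not unique: the ordinals are the notations up to [oeq]. *)
Inductive ord : Type :=
| ozero : ord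
| osucc of ord
| osup of (nat -> ord).

Inductive ole : ord -> ord -> Prop :=
| ole_zero b : ole ozero b
| ole_succ a b : ole a b -> ole (osucc a) (osucc b)
| ole_sup_l f b : (forall n, ole (f n) b) -> ole (osup f) b
| ole_sup_r a f n : ole a (f n) -> ole a (osup f).

Definition olt (a b : ord) : Prop := ole (osucc a) b.

Definition oeq (a b : ord) : Prop := ole a b /\ ole b a.

Fixpoint oadd (a b : ord) : ord :=
  match b with
  | ozero => a
  | osucc b' => osucc (oadd a b')
  | osup f => osup (fun n => oadd a (f n))
  end.

Fixpoint omuln (a : ord) (k : nat) : ord :=
  if k is k'.+1 then oadd (omuln a k') a else ozero.

(** [omega_pow g] is omega^g; the successor clause is
    omega^(g+1) = omega^g * omega = sup_k omega^g * k. *)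
Fixpoint omega_pow (g : ord) : ord :=
  match g with
  | ozero => osucc ozero
  | osucc g' => osup (omuln (omega_pow g'))
  | osup f => osup (fun n => omega_pow (f n))
  end.

Definition olimit (b : ord) : Prop :=
  olt ozero b /\ forall a, olt a b -> olt (osucc a) b.

Section OrdTheory.

Lemma ole_refl a : ole a a.
Proof.
elim: a => [|a IH|f IH]; [exact: ole_zero|exact: ole_succ|].
by apply: ole_sup_l => n; apply: ole_sup_r (IH n).
Qed.

Lemma ole_sup_lE f b : ole (osup f) b -> forall n, ole (f n) b.
Proof.
move=> H; move: {1 2}(osup f) H (erefl (osup f)) => s H.
elim: H f => [//|//|f' b' H _ f [<-] n|a f' m _ IH f E n]; first exact: H.
by apply: ole_sup_r; exact: IH E n.
Qed.

Lemma ole_succE a b : ole (osucc a) (osucc b) -> ole a b.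
Proof. by move=> H; inversion H. Qed.

Lemma olt_supE a f : olt a (osup f) -> exists n, olt a (f n).
Proof. by move=> H; inversion H; subst; exists n. Qed.

Lemma olt0 a : ~ olt a ozero.
Proof. by move=> H; inversion H. Qed.

Lemma ole_trans b a c : ole a b -> ole b c -> ole a c.
Proof.
move=> H; elim: H c => {a b}.
- by move=> b c _; exact: ole_zero.
- move=> a b _ IH c; elim: c => [|c _|f IHf] H; first by inversion H.
    by apply: ole_succ; apply: IH; exact: ole_succE.
  by have [n Hn] := olt_supE H; apply: ole_sup_r (IHf n Hn).
- by move=> f b _ IH c Hc; apply: ole_sup_l => n; exact: IH.
- by move=> a f n _ IH c /ole_sup_lE/(_ n); exact: IH.
Qed.

Lemma ole_succ_r a : ole a (osucc a).
Proof.
elim: a => [|a IH|f IH]; [exact: ole_zero|exact: ole_succ|].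
apply: ole_sup_l => n; apply: ole_trans (IH n) _.
by apply: ole_succ; apply: ole_sup_r (ole_refl _).
Qed.

Lemma oltW a b : olt a b -> ole a b.
Proof. by apply: ole_trans; exact: ole_succ_r. Qed.

Lemma ole_total a b : ole a b \/ olt b a.
Proof.
elim: a b => [b|a IH b|f IH b]; first by left; exact: ole_zero.
- elim: b => [|b _|g IHg].
  + by right; apply/ole_succ/ole_zero.
  + by case: (IH b) => H; [left|right]; exact: ole_succ.
  + have [[n Hn]|H] := pselect (exists n, ole (osucc a) (g n)).
      by left; apply: ole_sup_r Hn.
    right; apply/ole_succ/ole_sup_l => n; case: (IHg n) => [Hn|/ole_succE//].
    by case: H; exists n.
- have [[n Hn]|H] := pselect (exists n, olt b (f n)).
    by right; apply: ole_sup_r Hn.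
  left; apply: ole_sup_l => n; case: (IH n b) => // Hn.
  by case: H; exists n.
Qed.

Lemma olt_wf : well_founded olt.
Proof.
suff H a b : olt b a -> Acc olt b.
  by move=> a; apply: (H (osucc a)); exact: ole_refl.
elim: a b => [b /olt0//|a IH b /ole_succE ba|f IH b /olt_supE[n]]; last exact: IH.
by constructor=> c cb; apply: IH; exact: ole_trans ba.
Qed.

Lemma olt_irr a : ~ olt a a.
Proof.
elim/(well_founded_ind olt_wf): a => x IH xx; exact: (IH x xx xx).
Qed.

Lemma ord_least (P : set ord) :
  (exists a, P a) -> exists a, P a /\ forall b, P b -> ole a b.
Proof.
move=> [a]; elim/(well_founded_ind olt_wf): a => a IH Pa.
have [[b [ba Pb]]|H] := pselect (exists b, olt b a /\ P b); first exact: IH Pb.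
exists a; split=> // b Pb; case: (ole_total a b) => // ba.
by case: H; exists b.
Qed.

(** The elements of a countable well-founded order have ranks in [ord]; hence
    every countable ordinal is represented. *)
Lemma ord_rank (T : countType) (r : T -> T -> Prop) : well_founded r ->
  exists h : T -> ord, forall x, (forall y, r y x -> olt (h y) (h x)) /\
    forall a, (forall y, r y x -> olt (h y) a) -> ole (h x) a.
Proof.
move=> wf.
pose step x (h : forall y, r y x -> ord) := osup (fun n =>
  if unpickle n is Some y then
    if pselect (r y x) is left ryx then osucc (h y ryx) else ozero
  else ozero).
pose h := Fix wf (fun=> ord) step.
have hE x : h x = step x (fun y _ => h y).
  rewrite /h Fix_eq// => y g g' gg'; congr osup; apply/funext => n.
  by case: unpickle => // z; case: pselect => // rzy; rewrite gg'.
exists h => x; rewrite hE; split=> [y ryx|a ha].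
  apply: (@ole_sup_r _ _ (pickle y)); rewrite pickleK.
  by case: pselect => // _; exact: ole_refl.
apply: ole_sup_l => n; case: unpickle => [y|]; last exact: ole_zero.
by case: pselect => [/ha//|_]; exact: ole_zero.
Qed.

Lemma ole_addr a b : ole b (oadd a b).
Proof.
elim: b => [|b IH|f IH] /=; [exact: ole_zero|exact: ole_succ|].
by apply: ole_sup_l => n; apply: ole_sup_r (IH n).
Qed.

Lemma oadd_le2r a b c : ole a b -> ole (oadd a c) (oadd b c).
Proof.
move=> ab; elim: c => [//|c IH|f IH] /=; first exact: ole_succ.
by apply: ole_sup_l => n; apply: ole_sup_r (IH n).
Qed.

Lemma oadd_le2l a b c : ole b c -> ole (oadd a b) (oadd a c).
Proof.
have le_add x y : ole x (oadd x y).
  elim: y => [|y IH|f IH] /=; first exact: ole_refl.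
    exact: ole_trans (ole_succ_r _).
  exact: ole_sup_r 0%N (IH 0%N).
elim=> {b c} [b|b c _ IH|f b _ IH|b f n _ IH] /=.
- exact: le_add.
- exact: ole_succ.
- exact: ole_sup_l.
- exact: ole_sup_r IH.
Qed.

Lemma oadd_sub a b : ole a b -> exists c, oeq b (oadd a c).
Proof.
elim: b => [|b IH|f IH] ab.
- by exists ozero; split=> //; exact: ole_zero.
- case: (ole_total a b) => [/IH[c [bc cb]]|ba].
    by exists (osucc c); split; exact: ole_succ.
  by exists ozero.
- have /choice[c Hc] : forall n, exists c,
      ole (f n) (oadd a c) /\ ole (oadd a c) (osup f).
    move=> n; case: (ole_total a (f n)) => [/IH[c [fc cf]]|/oltW fa].
      by exists c; split=> //; exact: ole_sup_r cf.
    by exists ozero.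
  exists (osup c); split; apply: ole_sup_l => n; last exact: (Hc n).2.
  exact: ole_sup_r (Hc n).1.
Qed.

Lemma omega_pow_gt0 g : olt ozero (omega_pow g).
Proof.
elim: g => [|g IH|f IH] /=; first exact: ole_refl.
  apply: (@ole_sup_r _ _ 1%N); apply: ole_trans IH _; exact: ole_addr.
exact: ole_sup_r 0%N (IH 0%N).
Qed.

Lemma ole_omega_pow a : ole a (omega_pow a).
Proof.
elim: a => [|a IH|f IH] /=; first exact: ole_zero.
- apply: (@ole_sup_r _ _ 2); apply: (@ole_trans (osucc (omega_pow a))).
    exact: ole_succ.
  apply: (ole_trans (oadd_le2l (omega_pow a) (omega_pow_gt0 a))).
  by apply: oadd_le2r; exact: ole_addr.
- by apply: ole_sup_l => n; apply: ole_sup_r (IH n).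
Qed.

(** The decomposition alpha = omega^g * k + b, with b < omega^g. The proviso
    [k = 0 -> alpha = 0] makes (g, k) unique up to [oeq] for nonzero alpha
    (without it, k = 0 and any large g would be allowed). *)
Definition ord_decomp (alpha g : ord) (k : nat) (b : ord) : Prop :=
  [/\ oeq alpha (oadd (omuln (omega_pow g) k) b), olt b (omega_pow g) &
      k = 0%N -> oeq alpha ozero].

Lemma ord_decomp_ex alpha : exists g k b, ord_decomp alpha g k b.
Proof.
have : olt alpha (omega_pow (osucc alpha)).
  exact: ole_omega_pow (osucc alpha).
elim: (osucc alpha) => [/ole_succE a0|g IH|f IH /olt_supE[n]]; last exact: IH.
- exists ozero, 0%N, ozero; rewrite /ord_decomp /=.
  have a0' : oeq alpha ozero by split=> //; exact: ole_zero.
  by split=> //; exact: ole_refl.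
- move=> /olt_supE ex.
  have {ex} : exists k, asbool (olt alpha (omuln (omega_pow g) k)).
    by case: ex => k Hk; exists k; apply/asboolP.
  move=> /ex_minnP[[|k] /asboolP Hk kmin]; first by have := olt0 Hk.
  have gek : ole (omuln (omega_pow g) k) alpha.
    case: (ole_total (omuln (omega_pow g) k) alpha) => // /asboolP /kmin.
    by rewrite ltnn.
  case: k Hk gek {kmin} => [|k] Hk gek.
    apply: IH; apply: ole_trans Hk _ => /=.
    elim: (omega_pow g) => [|x Hx|h Hh] /=; first exact: ole_zero.
      exact: ole_succ.
    by apply: ole_sup_l => n; exact: ole_sup_r (Hh n).
  have [b ab] := oadd_sub gek; exists g, k.+1, b; split=> //.
  case: (ole_total (omega_pow g) b) => // gb.
  case: (@olt_irr alpha); apply: ole_trans Hk _.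
  by apply: ole_trans ab.2; exact: oadd_le2l.
Qed.

End OrdTheory.

Definition ord_half_spec (alpha h : ord) : Prop :=
  exists g k b, ord_decomp alpha g k b /\ h = omuln (omega_pow g) k.+1./2.

Lemma ord_half_ex alpha : exists h, ord_half_spec alpha h.
Proof.
have [g [k [b gkb]]] := ord_decomp_ex alpha.
by exists (omuln (omega_pow g) k.+1./2), g, k, b.
Qed.

Definition ord_half (alpha : ord) : ord := projT1 (cid (ord_half_ex alpha)).

(** Ordinals up to omega_1: [Some a] is the countable ordinal [a], and [None]
    is omega_1. *)
Definition ole1 (a b : option ord) : Prop :=
  match a, b with
  | _, None => True
  | None, Some _ => False
  | Some a, Some b => ole a b
  end.

Definition oeq1 (a b : option ord) : Prop := ole1 a b /\ ole1 b a.

(** Transfinite iteration of a derivation, with intersections at limits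
    (see [oiter_limit]). It depends only on the ordinal, not on its notation,
    by [oiter_le]. *)
Fixpoint oiter (T : Type) (D : set T -> set T) (A : set T) (a : ord) : set T :=
  match a with
  | ozero => A
  | osucc b => D (oiter D A b)
  | osup f => \bigcap_n oiter D A (f n)
  end.

Lemma oiter_le (T : Type) (D : set T -> set T) (A : set T) (a b : ord) :
  {homo D : B C / B `<=` C} -> (forall B, D B `<=` B) ->
  ole a b -> oiter D A b `<=` oiter D A a.
Proof.
move=> Dmono Ddefl; elim=> {a b} [b|a b _ IH|f b _ IH|a f n _ IH] /=.
- elim: b => [//|b IH|f IH] /= x; first by move=> /Ddefl/IH.
  by move=> /(_ 0%N I)/IH.
- exact: Dmono.
- by move=> x bx n _; exact: IH.
- by move=> x /(_ n I); exact: IH.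
Qed.

Lemma oiter_limit (T : Type) (D : set T -> set T) (A : set T) (b : ord) :
  {homo D : B C / B `<=` C} -> (forall B, D B `<=` B) -> olimit b ->
  oiter D A b = \bigcap_(a in [set a | olt a b]) oiter D A a.
Proof.
move=> Dmono Ddefl lb; apply/seteqP; split=> [x bx a /= /oltW ab|x].
  exact: (oiter_le Dmono Ddefl ab).
elim: b lb => [[/olt0//]|b _ [_ lb]|f IH [f0 lf] H n _].
  by have /olt_irr := lb b (ole_refl (osucc b)).
case: (ole_total (osup f) (f n)) => [ffn|]; last exact: H.
apply: IH => [|a /= an]; last by apply: H; apply: ole_sup_r an.
split=> [|a an]; first exact: ole_trans ffn.
by apply: (ole_trans _ ffn); apply: lf; apply: ole_sup_r an.
Qed.

Section Oscillation.
Context {R : realType} {K : topologicalType}.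
Implicit Types (eps : R) (f : nat -> K -> R).

Definition osc_plus eps f (n m : nat) : set K := [set k | eps < f n k - f m k].

Definition osc_minus eps f (n m : nat) : set K :=
  [set k | f n k - f m k < - eps].

Definition osc_deriv eps f (A : set K) : set K :=
  [set k | A k /\ forall U : set K, nbhs k U ->
    exists N : nat, forall n, (N <= n)%N -> exists M : nat,
      ((\bigcap_(m in [set m | (M <= m)%N]) osc_plus eps f n m)
         `&` A `&` U !=set0) \/
      ((\bigcap_(m in [set m | (M <= m)%N]) osc_minus eps f n m)
         `&` A `&` U !=set0)].

Definition osc_set eps f (alpha : ord) : set K :=
  oiter (osc_deriv eps f) setT alpha.

Lemma osc_deriv_homo eps f : {homo osc_deriv eps f : A B / A `<=` B}.
Proof.
move=> A B AB k [Ak H]; split=> [|U /H[N HN]]; first exact: AB.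
exists N => n /HN[M HM]; exists M.
by case: HM => -[x [[xI /AB Bx] Ux]]; [left|right]; exists x.
Qed.

Lemma osc_deriv_sub eps f (A : set K) : osc_deriv eps f A `<=` A.
Proof. by move=> k []. Qed.

End Oscillation.

Section Trees.
Context {S : Type}.
Implicit Type T : set (seq S).

(** Nodes are nonempty finite sequences. *)
Definition is_tree T : Prop :=
  (forall s, T s -> s <> [::]) /\
  (forall s t, s <> [::] -> T (s ++ t) -> T s).

Definition tree_deriv T : set (seq S) :=
  [set s | T s /\ exists x, T (rcons s x)].

Definition tree_iter T (alpha : ord) : set (seq S) := oiter tree_deriv T alpha.

Lemma tree_deriv_homo : {homo tree_deriv : T T' / T `<=` T'}.
Proof. by move=> T T' TT' s [/TT' ? [x /TT' ?]]; split=> //; exists x. Qed.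

Lemma tree_deriv_sub T : tree_deriv T `<=` T.
Proof. by move=> s []. Qed.

(** [tree_order_spec T o]: [o] is the least ordinal at which the derivatives of
    [T] are exhausted, with [o] = omega_1 if no countable ordinal works. *)
Definition tree_order_spec T (o : option ord) : Prop :=
  match o with
  | Some g => tree_iter T g = set0 /\
              forall a, tree_iter T a = set0 -> ole g a
  | None => forall a, tree_iter T a !=set0
  end.

Lemma tree_order_ex T : exists o, tree_order_spec T o.
Proof.
have [ex|H] := pselect (exists a, tree_iter T a = set0).
  by have [g [Hg gmin]] := ord_least ex; exists (Some g).
exists None => a; apply/set0P/eqP => Ta; by apply: H; exists a.
Qed.

Definition tree_order T : option ord := projT1 (cid (tree_order_ex T)).

End Trees.

Section Ell1.
Context {R : realType} {V : normedModType R}.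

Definition lin_span (f : nat -> V) : set V :=
  [set g | exists n (c : 'I_n -> R), g = \sum_(i < n) c i *: f i].

Definition closed_span (f : nat -> V) : set V := closure (lin_span f).

(** The Banach space is given as a (closed linear) subspace [X] of [V]. *)
Definition ell1_tree (X : set V) (delta : R) : set (seq V) :=
  [set s | [/\ s <> [::],
    forall x, x \in s -> X x /\ `|x| <= 1 &
    forall lambda : 'I_(size s) -> R,
      delta * (\sum_(i < size s) `|lambda i|) <=
      `|\sum_(i < size s) lambda i *: s`_i| ]].

Definition ell (X : set V) (delta : R) : option ord :=
  tree_order (ell1_tree X delta).

(** An l^1-index tree on [f], with unspecified constant [delta]. *)
Definition ell1_index_tree_on (f : nat -> V) (T : set (seq V)) : Prop :=
  [/\ is_tree T,
    (exists2 delta : R, 0 < delta & T `<=` ell1_tree (closed_span f) delta) &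
    forall s, T s -> forall x, x \in s -> exists n, x = f n].

End Ell1.

(** The normed space C(K), for K compact, with the supremum norm (which is 0 if
    K is empty, since [sup set0 = 0]). The compactness proof is a parameter of
    the type because the norm is only a norm when K is compact. *)
Section ContinuousFunctions.
Context {R : realType} {K : topologicalType}.

Definition continuous_pred : {pred K -> R^o} :=
  [pred f : K -> R^o | `[< continuous f >]].

Record contfun (cK : compact [set: K]) : Type := ContFun {
  contfun_fun :> K -> R^o;
  contfunP : contfun_fun \in continuous_pred }.

Lemma continuous_predP (f : K -> R^o) :
  reflect (continuous f) (f \in continuous_pred).
Proof. exact: asboolP. Qed.

Lemma continuous_pred_submod : submod_closed continuous_pred.
Proof.
split=> [|a f g /continuous_predP cf /continuous_predP cg].
  by apply/continuous_predP => x; exact: cvg_cst.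
apply/continuous_predP => x.
by apply: cvgD; [apply: cvgZr; exact: cf|exact: cg].
Qed.

HB.instance Definition _ :=
  GRing.isSubmodClosed.Build _ _ continuous_pred continuous_pred_submod.

Context (cK : compact [set: K]).

HB.instance Definition _ := [isSub for @contfun_fun cK].
HB.instance Definition _ := [Choice of contfun cK by <:].
HB.instance Definition _ := [SubChoice_isSubLmodule of contfun cK by <:].

Definition supnorm (f : contfun cK) : R := sup [set `|f k| | k in [set: K]].

Lemma supnorm_ub (f : contfun cK) k : `|f k| <= supnorm f.
Proof.
have cf : continuous f by apply/continuous_predP; exact: contfunP.
have /compact_bounded[M [_ MB]] :=
  continuous_compact (continuous_subspaceT cf) cK.
apply: ub_le_sup; last by exists k.
exists (M + 1) => _ [x _ <-]; apply: (MB (M + 1)); first by rewrite ltrDl.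
by exists x.
Qed.

Lemma supnorm_le (f : contfun cK) c :
  0 <= c -> (forall k, `|f k| <= c) -> supnorm f <= c.
Proof.
move=> c0 fc; rewrite /supnorm; set A := [set _ | _ in _].
have [->|/set0P A0] := eqVneq A set0; first by rewrite sup0.
by apply: ge_sup => // _ [k _ <-]; exact: fc.
Qed.

Lemma supnorm_ge0 (f : contfun cK) : 0 <= supnorm f.
Proof.
rewrite /supnorm; set A := [set _ | _ in _].
have [->|/set0P[_ [k _ _]]] := eqVneq A set0; first by rewrite sup0.
exact: le_trans (supnorm_ub f k).
Qed.

Lemma supnormD (f g : contfun cK) : supnorm (f + g) <= supnorm f + supnorm g.
Proof.
apply: supnorm_le => [|k]; first by rewrite addr_ge0 ?supnorm_ge0.
by apply: le_trans (ler_normD _ _) _; rewrite lerD ?supnorm_ub.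
Qed.

Lemma supnormZ (l : R) (f : contfun cK) : supnorm (l *: f) = `|l| * supnorm f.
Proof.
have le (m : R) (g : contfun cK) : supnorm (m *: g) <= `|m| * supnorm g.
  apply: supnorm_le => [|k]; first by rewrite mulr_ge0 ?supnorm_ge0.
  by rewrite [(m *: g) k]/(m * g k) normrM ler_wpM2l ?supnorm_ub.
apply/eqP; rewrite eq_le le /=.
have [->|l0] := eqVneq l 0; first by rewrite normr0 mul0r supnorm_ge0.
have := le l^-1 (l *: f); rewrite scalerA mulVf// scale1r normfV.
by rewrite mulrC ler_pdivlMr ?normr_gt0// mulrC.
Qed.

Lemma supnorm_eq0 (f : contfun cK) : supnorm f = 0 -> f = 0.
Proof.
move=> f0; apply/val_inj/funext => k /=.
by apply/eqP; rewrite -normr_le0 -f0 supnorm_ub.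
Qed.

HB.instance Definition _ :=
  Lmodule_isNormed.Build R (contfun cK) supnormD supnormZ supnorm_eq0.

End ContinuousFunctions.

(* Main.v *)
Require Import Defs.
From HB Require Import structures.
From mathcomp Require Import all_boot all_order all_algebra.
From mathcomp Require Import all_classical all_reals all_analysis.
From mathcomp Require Import lra zify.

Set Implicit Arguments.
Unset Strict Implicit.
Unset Printing Implicit Defensive.

Import Order.TTheory GRing.Theory Num.Theory.
Import numFieldNormedType.Exports.

Local Open Scope classical_set_scope.
Local Open Scope ring_scope.

(** Write [F] for the pointwise limit of [f]. If a point [x] survives [a + 1]
    oscillation derivatives, then near [x], for all large [n], there are points
    that survive [a] derivatives and at which [f n] differs from [F] by at least
    [eps]. Such points are the source of an l^1 estimate in the style of
    Rosenthal: a sequence of functions has lower l^1 constant [d / 2] as soon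
    as each function takes, on every prescribed pattern of highs and lows,
    values above [r + d] at the highs and below [r] at the lows, where the
    threshold [r] may depend on the function ([independent_on_l1]).

    Given finitely many points, one for each pattern on a sequence [s], the
    sequence is extended as follows ([independent_on_extend]). Near each point
    there is an oscillation point for some index [m]; there [f n] is close to
    [F] for all large [n], which gives the low values. Near each point there is
    also an oscillation point for such a large index [n], and there [f n] exceeds
    [F] by [eps], which gives the high values. The limit [F] is not continuous,
    but the two values can be compared if the oscillations have the same sign
    and [F] is nearly constant on the oscillation points that are used. This
    costs one derivative, so iterated derivatives become iterated extensions,
    that is, nodes of large rank in the tree of independent sequences
    ([tree_iter_word]).

    It remains to make the sign and the approximate value of [F] uniform over
    the points of one step. There are finitely many such letters. A
    nonprincipal ultrafilter on the indices splits the oscillation derivative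
    into one derivation per letter ([osc_set_letters]); these derivations are
    finitely additive on closed sets. Since a power of omega is additively
    indecomposable, [omega^g] steps with mixed letters contain [omega^g] steps
    with a single letter ([homogeneous_omega_pow]). Hence [omega^g * k + b]
    derivatives yield a word of [k] homogeneous blocks, and half of them,
    rounded up, have the same sign ([majority_subword]); dropping the other
    blocks is what replaces the ordinal by its half.

    Finally, a tree of order exactly [h] is obtained from one of order at least
    [h]. The tree of independent sequences is well founded, because on a compact
    space an infinite independent sequence has a point of divergence
    ([no_independent_subsequence]); so it has a node of rank exactly [h], and
    the part of the tree above this node has order [h] ([subtree_of_order]). *)

(** * Pigeonhole principles *)

Lemma finite_upper_bound (J : Type) (le : J -> J -> Prop) (I : finType)
    (g : I -> J) (j0 : J) :
  (forall a b c, le a b -> le b c -> le a c) ->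
  (forall a b, exists2 c, le a c & le b c) ->
  exists j, forall i, le (g i) j.
Proof.
move=> le_trans dir.
have [j jP] : exists j, forall i, i \in enum I -> le (g i) j.
  elim: (enum I) => [|i s [j IH]]; first by exists j0.
  have [c gc jc] := dir (g i) j; exists c => i'; rewrite in_cons.
  by case/orP => [/eqP->//|/IH gj]; exact: le_trans jc.
by exists j => i; apply: jP; rewrite mem_enum.
Qed.

(** The typical use is with the neighbourhoods of a point or the terms of an
    ordinal supremum as [J]: a class that can be chosen for each [j] can be
    chosen independently of [j], since otherwise the classes would fail at
    finitely many places, hence all at a common bound. *)
Lemma directed_pigeonhole (J : Type) (le : J -> J -> Prop) (I : finType)
    (P : I -> J -> Prop) (j0 : J) :
  (forall a b c, le a b -> le b c -> le a c) ->
  (forall a b, exists2 c, le a c & le b c) ->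
  (forall i a b, le a b -> P i b -> P i a) ->
  (forall j, exists i, P i j) -> exists i, forall j, P i j.
Proof.
move=> le_trans dir anti ex; apply: contrapT => none.
have /choice[g gP] : forall i, exists j, ~ P i j.
  by move=> i; apply: contrapT => H; apply: none; exists i => j;
    apply: contrapT => Pij; apply: H; exists j.
have [j gj] := finite_upper_bound g j0 le_trans dir.
by have [i Pij] := ex j; apply: (gP i); exact: anti (gj i) Pij.
Qed.

Lemma sup_pigeonhole (I : finType) (u : nat -> ord) (P : I -> ord -> Prop) :
  (forall i a b, ole a b -> P i b -> P i a) ->
  (forall n, exists i, P i (u n)) -> exists i, forall n, P i (u n).
Proof.
move=> anti; apply: (@directed_pigeonhole _ (fun n m => ole (u n) (u m))) => //.
- exact: 0%N.
- by move=> a b c; exact: ole_trans.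
- move=> n m; case: (ole_total (u n) (u m)) => [nm|/oltW mn].
    by exists m => //; exact: ole_refl.
  by exists n => //; exact: ole_refl.
- by move=> i n m; exact: anti.
Qed.

Lemma ultrafilter_pigeonhole (T : Type) (p : set_system T) (I : finType)
    (P : I -> set T) :
  UltraFilter p -> p [set t | exists i, P i t] -> exists i, p (P i).
Proof.
move=> pU pP; apply: contrapT => none.
have pC : p [set t | forall i, ~ P i t].
  apply: (@filter_forall _ _ (fun i => ~` P i)) => i.
  by case: (in_ultra_setVsetC (P i) pU) => // Pi; case: none; exists i.
by have [t [[i Pit] /(_ i)]] := filter_ex (filterI pP pC).
Qed.

(** * Transfinite iteration *)

Lemma ole_add a b : ole a (oadd a b).
Proof. exact: oadd_le2l (ole_zero b). Qed.

Lemma omuln_le a m n : (m <= n)%N -> ole (omuln a m) (omuln a n).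
Proof.
move=> /subnKC <-; elim: (n - m)%N => [|k IH]; first by rewrite addn0; exact: ole_refl.
by rewrite addnS; apply: ole_trans IH _; exact: ole_add.
Qed.

Section Iteration.
Context {T : Type}.
Implicit Types (A B : set T) (D : set T -> set T).

Lemma oiter_add D A a b : oiter D A (oadd a b) = oiter D (oiter D A a) b.
Proof. by elim: b => //= [b ->//|u IH]; apply: eq_bigcapr => n _; exact: IH. Qed.

Lemma oiter_homo D D' A B a : {homo D : X Y / X `<=` Y} ->
  (forall X, D X `<=` D' X) -> A `<=` B -> oiter D A a `<=` oiter D' B a.
Proof.
move=> Dmono DD' AB; elim: a => //= [a IH|u IH].
  by apply: subset_trans (DD' _); exact: Dmono.
by move=> x ux n _; exact: IH (ux n I).
Qed.

Lemma oiter_sub D A a : (forall X, D X `<=` X) -> oiter D A a `<=` A.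
Proof.
move=> Ddefl; elim: a => //= [a IH|u IH]; first exact: subset_trans IH.
by move=> x /(_ 0%N I); exact: IH.
Qed.

End Iteration.

(** * Homogeneous subwords of an iterated derivation *)

Section Homogeneous.
Context {T : topologicalType} {S : finType} (D : S -> set T -> set T).
Hypothesis D_homo : forall s, {homo D s : A B / A `<=` B}.
Hypothesis D_sub : forall s A, D s A `<=` A.
Hypothesis D_closed : forall s A, closed A -> closed (D s A).
Hypothesis D_additive : forall s (J : finType) (A : J -> set T),
  (forall i, closed (A i)) -> D s (\bigcup_i A i) `<=` \bigcup_i D s (A i).

Definition union_deriv (A : set T) : set T := \bigcup_s D s A.

Lemma union_deriv_homo : {homo union_deriv : A B / A `<=` B}.
Proof. by move=> A B AB x [s _ sx]; exists s => //; exact: D_homo sx. Qed.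

Lemma union_deriv_sub A : union_deriv A `<=` A.
Proof. by move=> x [s _]; exact: D_sub. Qed.

Lemma oiter_closed s A a : closed A -> closed (oiter (D s) A a).
Proof.
move=> cA; elim: a => //= [a IH|u IH]; first exact: D_closed.
by apply: closed_bigI => n _; exact: IH.
Qed.

Lemma oiter_additive s (J : finType) (A : J -> set T) a :
  (forall i, closed (A i)) ->
  oiter (D s) (\bigcup_i A i) a `<=` \bigcup_i oiter (D s) (A i) a.
Proof.
move=> cA; elim: a => //= [a IH|u IH].
  apply: subset_trans (D_homo IH) _; apply: D_additive => i; exact: oiter_closed.
move=> x ux.
have [i xi] : exists i, forall n, oiter (D s) (A i) (u n) x.
  apply: (@sup_pigeonhole _ _ (fun i a => oiter (D s) (A i) a x)) => [i a b ab|n].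
    by apply: oiter_le => //; exact: D_homo.
  by have [i _ ix] := IH n x (ux n I); exists i.
by exists i => // n _.
Qed.

(** The first letter is applied last: it is the one met first on the way down
    from a point of the iterated set to [A]. *)
Definition word_deriv (a : ord) (A : set T) (w : seq S) : set T :=
  foldr (fun s B => oiter (D s) B a) A w.

Lemma word_deriv_closed a A w : closed A -> closed (word_deriv a A w).
Proof. by move=> cA; elim: w => //= s w; exact: oiter_closed. Qed.

(** Letters may be dropped because the derivations are decreasing. *)
Lemma word_deriv_subseq a A v w :
  subseq v w -> word_deriv a A w `<=` word_deriv a A v.
Proof.
elim: w v => [|s w IH] [|s' v] //=; first by move=> _ x.
  by move=> _; apply: subset_trans (IH [::] _); [exact: oiter_sub|exact: sub0seq].
case: eqP => [-> vw|_ vw].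
  exact: (oiter_homo (@D_homo s) (fun=> @subset_refl _ _) (IH v vw)).
by apply: subset_trans (IH (s' :: v) vw); exact: oiter_sub.
Qed.

Lemma word_deriv_nseq a A s m :
  word_deriv a A (nseq m s) = oiter (D s) A (omuln a m).
Proof. by elim: m => //= m ->; rewrite oiter_add. Qed.

Lemma count_pigeonhole (w : seq S) m :
  (#|S| * m < size w)%N -> exists s, (m < count_mem s w)%N.
Proof.
move=> mw; apply/existsP; apply: contraLR mw; rewrite negb_exists -leqNgt.
move=> /forallP H; rewrite -sum1_size (partition_big id predT)//=.
apply: leq_trans (_ : \sum_(s : S) m <= _)%N; last by rewrite sum_nat_const.
by apply: leq_sum => s _; rewrite sum1_count leqNgt; exact: H.
Qed.

Definition homogeneous a := forall A, closed A ->
  oiter union_deriv A a `<=` \bigcup_s oiter (D s) A a.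

(** Splitting into blocks of length [a]: each block is homogeneous, and the
    choice of its letter is finite, hence can be pulled out by additivity. *)
Lemma oiter_omuln_word a k A : homogeneous a -> closed A ->
  oiter union_deriv A (omuln a k) `<=`
  \bigcup_(w : k.-tuple S) word_deriv a A w.
Proof.
move=> hom cA; elim: k => [|k IH] /=; first by move=> x Ax; exists [tuple].
rewrite oiter_add; set B := \bigcup_(w : k.-tuple S) word_deriv a A w in IH.
have cB : closed B.
  apply: closed_bigcup => [|w _]; last exact: word_deriv_closed.
  exact: finite_finset.
move=> x /(oiter_homo union_deriv_homo (fun _ => @subset_refl _ _) IH).
move=> /(hom _ cB)[s _ /oiter_additive[w|w _ wx]].
  exact: word_deriv_closed.
by exists (cons_tuple s w).
Qed.

(** Indecomposability: a power of omega does not split among finitely many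
    classes. At a successor, among [#|S| * m + 1] homogeneous blocks more
    than [m] carry the same letter. *)
Lemma homogeneous_omega_pow g : homogeneous (omega_pow g).
Proof.
elim: g => [|g IH|u IH] A cA x ux //.
- have [s sx] : exists s, forall m, oiter (D s) A (omuln (omega_pow g) m) x.
    apply: (@sup_pigeonhole S (omuln (omega_pow g))
      (fun s a => oiter (D s) A a x)) => [s a b ab|m].
      by apply: oiter_le => //; exact: D_homo.
    have [w _ wx] := oiter_omuln_word IH cA (ux (#|S| * m).+1 I).
    have [|s ms] := @count_pigeonhole w m; first by rewrite size_tuple.
    exists s; apply: (oiter_le (@D_homo s) (@D_sub s) (omuln_le _ (ltnW ms))).
    rewrite -word_deriv_nseq; apply: word_deriv_subseq wx.
    by rewrite -size_filter -(all_pred1P _ _ (filter_all _ _)) filter_subseq.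
  by exists s => // m _.
- have [s sx] : exists s, forall n, oiter (D s) A (omega_pow (u n)) x.
    apply: (@sup_pigeonhole S (fun n => omega_pow (u n))
      (fun s a => oiter (D s) A a x)) => [s a b ab|n].
      by apply: oiter_le => //; exact: D_homo.
    by have [s _ sx] := IH n A cA x (ux n I); exists s.
  by exists s => // n _.
Qed.

End Homogeneous.

(** * Independent sequences of continuous functions *)

Section Independence.
Context {R : realType} {K : topologicalType} {cK : compact [set: K]}.
Context {C : finType} (thr : C -> R) (b : bool) (d : R).
Implicit Types (s t : seq (@contfun R K cK)) (A : set K).

(** The values are multiplied by the sign [(-1) ^+ b], so that oscillations of
    either sign are treated as upward ones. The thresholds are indexed by a
    finite type, so that some threshold recurs in every infinite sequence. *)
Definition separated (c : C) (h : K -> R) (high : bool) (k : K) : Prop :=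
  if high then thr c + d < (-1) ^+ b * h k else (-1) ^+ b * h k < thr c.

(** [J] is the pattern: the indices at which the value has to be high. *)
Definition independent_on A s : Prop :=
  exists c : nat -> C, forall J : nat -> bool, exists2 k, A k &
    forall l, (l < size s)%N -> separated (c l) (s`_l) (J l) k.

Lemma independent_on_sub A B s :
  A `<=` B -> independent_on A s -> independent_on B s.
Proof.
by move=> AB [c cP]; exists c => J; have [k Ak kP] := cP J; exists k => //;
  exact: AB.
Qed.

Lemma independent_on_catl A s t :
  independent_on A (s ++ t) -> independent_on A s.
Proof.
move=> [c cP]; exists c => J; have [k Ak kP] := cP J; exists k => // l ls.
by have := kP l; rewrite size_cat nth_cat ls; apply; rewrite ltn_addr.
Qed.

Lemma independent_on_catr A s t :
  independent_on A (s ++ t) -> independent_on A t.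
Proof.
move=> [c cP]; exists (fun l => c (size s + l)%N) => J.
have [k Ak kP] := cP (fun l => J (l - size s)%N); exists k => // l lt.
have := kP (size s + l)%N; rewrite size_cat ltn_add2l nth_cat.
by rewrite (ltnNge (_ + _)%N) leq_addr /= addKn; exact.
Qed.

Lemma contfun_sumE n (lambda : 'I_n -> R) (h : 'I_n -> @contfun R K cK) k :
  (\sum_(i < n) lambda i *: h i) k = \sum_(i < n) lambda i * h i k.
Proof. exact: (big_morph (fun h : @contfun R K cK => h k : R)). Qed.

(** Rosenthal's argument: evaluate at a point whose pattern is the sign pattern
    of the coefficients, and at a point of the opposite pattern; the two values
    differ by at least [d * \sum_i `|lambda i|]. *)
Lemma independent_on_l1 A s (lambda : 'I_(size s) -> R) :
  independent_on A s ->
  d / 2 * (\sum_(i < size s) `|lambda i|) <=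
  `|\sum_(i < size s) lambda i *: s`_i|.
Proof.
move=> [c cP]; pose h : @contfun R K cK := \sum_(i < size s) lambda i *: s`_i.
rewrite -/h.
pose J l := if insub l is Some i then 0 <= lambda i else false.
have JE (i : 'I_(size s)) : J i = (0 <= lambda i) by rewrite /J valK.
have [k1 _ k1P] := cP J; have [k2 _ k2P] := cP (fun l => ~~ J l).
have le_h k : `|(-1) ^+ b * (h k : R)| <= `|h|.
  by rewrite normrMsign; exact: supnorm_ub.
have hE k : (-1) ^+ b * (h k : R) = \sum_i lambda i * ((-1) ^+ b * s`_i k).
  by rewrite /h contfun_sumE mulr_sumr; apply: eq_bigr => i _; rewrite mulrCA.
have gap : d * (\sum_i `|lambda i|) <=
    (-1) ^+ b * (h k1 : R) - (-1) ^+ b * (h k2 : R).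
  rewrite !hE -sumrB mulr_sumr; apply: ler_sum => i _; rewrite -mulrBr.
  have := k1P i (ltn_ord i); have := k2P i (ltn_ord i).
  rewrite /separated JE; case: (lerP 0 (lambda i)) => li /= lo hi.
    by rewrite ger0_norm// [d * _]mulrC ler_wpM2l//; lra.
  by rewrite ltr0_norm// [d * _]mulrC mulNr -mulrN ler_wnM2l ?(ltW li)//; lra.
have := ler_norm ((-1) ^+ b * (h k1 : R)); have := le_h k1; have := le_h k2.
have := ler_norm (- ((-1) ^+ b * (h k2 : R))); rewrite normrN.
move: gap; lra.
Qed.

Lemma injective_tends_to_infinity (n : nat -> nat) N :
  injective n -> exists i0, forall i, (i0 <= i)%N -> (N <= n i)%N.
Proof.
move=> inj; elim: N => [|N [i0 IH]]; first by exists 0%N.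
have [[i1 i1N]|none] := pselect (exists i, n i = N); last first.
  exists i0 => i /IH; rewrite leq_eqVlt => /orP[/eqP E|//].
  by case: none; exists i.
exists (maxn i0 i1.+1) => i; rewrite geq_max => /andP[/IH le_N lt_i].
rewrite ltn_neqAle le_N andbT; apply: contraTneq lt_i => E.
by rewrite (inj i i1) ?ltnn// i1N.
Qed.

(** The pattern alternates along the enumeration of [I]: two consecutive elements
    of [I] get different values. *)
Lemma parity_splitting (I : pred nat) :
  (forall N, exists2 i, (N <= i)%N & I i) ->
  exists J : nat -> bool, forall N, exists i l,
    [/\ (N <= i)%N, (N <= l)%N, I i, I l & J i && ~~ J l].
Proof.
move=> inf; pose cnt i := count I (iota 0 i); exists (fun i => odd (cnt i)) => N.
have [i Ni Ii] := inf N.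
have : exists l, (i < l)%N && I l by have [l il Il] := inf i.+1; exists l; rewrite il.
move=> /ex_minnP[l /andP[il Il] lmin].
have E : cnt l = (cnt i).+1.
  rewrite /cnt -(subnKC il) addSnnS iotaD count_cat add0n /= Ii add1n addnS.
  congr (_.+1); rewrite -[RHS]addn0; congr addn.
  apply/eqP; rewrite -leqn0 leqNgt -has_count; apply/hasPn => m.
  rewrite mem_iota => /andP[im ml]; apply/negP => Im.
  move: ml; rewrite subnKC// ltnNge => /negP; apply.
  by apply: lmin; rewrite im.
have Nl : (N <= l)%N by exact: leq_trans Ni (ltnW il).
by case Ei : (odd (cnt i)); [exists i, l|exists l, i]; rewrite E /= Ei.
Qed.

Hypothesis d_gt0 : 0 < d.

(** The closed version of [separated], which passes to limits of points. *)
Definition weakly_separated (c : C) (h : K -> R) (high : bool) (k : K) : Prop :=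
  if high then thr c + d <= (-1) ^+ b * h k else (-1) ^+ b * h k <= thr c.

Lemma closed_weakly_separated c (h : @contfun R K cK) high :
  closed (weakly_separated c h high).
Proof.
have ch : continuous (fun k => (-1) ^+ b * (h k : R)).
  move=> k; apply: cvgM; first exact: cvg_cst.
  exact: (elimT (continuous_predP _) (contfunP h)).
case: high; rewrite /weakly_separated.
  exact: (preimage_closed (fun k _ => ch k) (@closed_ge R _)).
exact: (preimage_closed (fun k _ => ch k) (@closed_le R _)).
Qed.
Lemma open_separated c (h : @contfun R K cK) high : open (separated c h high).
Proof.
have ch : continuous (fun k => (-1) ^+ b * (h k : R)).
  move=> k; apply: cvgM; first exact: cvg_cst.
  exact: (elimT (continuous_predP _) (contfunP h)).
case: high; rewrite /separated.
  exact: (open_comp (fun k _ => ch k) (@open_gt R _)).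
exact: (open_comp (fun k _ => ch k) (@open_lt R _)).
Qed.

(** Compactness turns the finite patterns into infinite ones; the thresholds,
    which depend on the length of the initial segment, are made coherent by an
    ultrafilter. *)
Lemma independent_prefixes_limit (h : nat -> @contfun R K cK) :
  (forall n, independent_on [set: K] (mkseq h n)) ->
  exists c : nat -> C, forall J : nat -> bool, exists k,
    forall i, weakly_separated (c i) (h i) (J i) k.
Proof.
move=> /choice[cn cnP].
have [p [pU p_infty]] := @ultraFilterLemma nat \oo _.
have /choice[c pc] : forall i, exists c, p [set n | cn n i = c].
  move=> i; apply: ultrafilter_pigeonhole; apply: filterS filterT => n _.
  by exists (cn n i).
exists c => J.
have /choice[k kP] : forall n, exists k, forall l, (l < n)%N ->
    separated (cn n l) (h l) (J l) k.
  move=> n; have [k _ kP] := cnP n J; exists k => l ln.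
  by have := kP l; rewrite size_mkseq nth_mkseq//; exact.
have [x [_ clx]] := @cK (k @ p) _ filterT; exists x => i.
apply: closed_weakly_separated => U xU; apply: clx => //.
have pi : p [set n | (i < n)%N] by apply: p_infty; exists i.+1.
suff : p [set n | weakly_separated (c i) (h i) (J i) (k n)] by [].
apply: (@filterS _ p _ _ _ _ (filterI (pc i) pi)) => n [] /= <- /kP.
by rewrite /separated /weakly_separated; case: (J i) => /ltW.
Qed.

Lemma independent_prefixes_injective (h : nat -> @contfun R K cK) :
  (forall n, independent_on [set: K] (mkseq h n)) -> injective h.
Proof.
move=> /independent_prefixes_limit[c cP] i l E; apply/eqP/negPn/negP => il.
have [k1 k1P] := cP (pred1 i); have [k2 k2P] := cP (pred1 l).
move: (k1P i) (k1P l) (k2P i) (k2P l); rewrite /weakly_separated /= !eqxx.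
rewrite (eq_sym l i) (negbTE il) E.
by move: d_gt0 {E}; lra.
Qed.

(** If all the initial segments were independent, infinitely many terms would
    share a threshold, and a point that realises an alternating pattern on them
    would be a point of divergence. *)
Lemma no_independent_subsequence (f h : nat -> @contfun R K cK) :
  (forall k : K, cvgn (fun n => f n k : R)) ->
  (forall i, exists n, h i = f n) ->
  ~ (forall n, independent_on [set: K] (mkseq h n)).
Proof.
move=> f_cvg /choice[n hf] ind.
have n_inj : injective n.
  by move=> i l E; apply: (independent_prefixes_injective ind); rewrite !hf E.
have [c cP] := independent_prefixes_limit ind.
have [p [pU p_infty]] := @ultraFilterLemma nat \oo _.
have [c0 pc0] : exists c0, p [set i | c i = c0].
  by apply: ultrafilter_pigeonhole; apply: filterS filterT => i _; exists (c i).
have [|J JP] := @parity_splitting (fun i => c i == c0).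
  move=> N; have pN : p [set i | (N <= i)%N] by apply: p_infty; exists N.
  by have [i [/eqP ci Ni]] := filter_ex (filterI pc0 pN); exists i.
have [k kP] := cP J.
have [N _ NP] : \forall m \near \oo, `|f m k - limn (fun m => f m k : R)| < d / 2.
  have /cvgrPdist_lt/(_ (d / 2)) := f_cvg k; rewrite divr_gt0// => /(_ isT).
  by apply: filterS => m; rewrite distrC.
have [i0 i0P] := injective_tends_to_infinity N n_inj.
have [i [l [/i0P Ni /i0P Nl /eqP ci /eqP cl /andP[Ji Jl]]]] := JP i0.
have := kP i; have := kP l.
rewrite /weakly_separated Ji (negbTE Jl) ci cl !hf => lo hi.
have := NP _ Ni; have := NP _ Nl => /=; set L := limn _.
move: d_gt0 lo hi {hf ci cl}; rewrite !mulr_sign; case: b => /= d0 lo hi.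
  by rewrite !ltr_norml => /andP[? ?] /andP[? ?]; lra.
by rewrite !ltr_norml => /andP[? ?] /andP[? ?]; lra.
Qed.

End Independence.

(** * Trees with a prescribed order *)

Section TreeOrder.
Context {S : Type}.
Implicit Types (T P : set (seq S)) (s t : seq S) (a h : ord).

Lemma tree_order_ge T h : (forall a, olt a h -> tree_iter T a !=set0) ->
  ole1 (Some h) (tree_order T).
Proof.
move=> Th; rewrite /tree_order; case: cid => -[g|//] /= [Tg _].
case: (ole_total h g) => // /Th; rewrite Tg => -[s []].
Qed.

Lemma tree_order_eq T h : (forall a, olt a h -> tree_iter T a !=set0) ->
  tree_iter T h = set0 -> oeq1 (tree_order T) (Some h).
Proof.
move=> Th T0; split; last exact: tree_order_ge.
rewrite /tree_order; case: cid => -[g|] /=; first by move=> [_]; exact.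
by move=> /(_ h); rewrite T0 => -[s []].
Qed.

(** The trees [P] below contain the root [[::]], whose rank is the order of the
    tree of nonempty nodes; this makes the order a rank like any other. *)
Definition nonempty_nodes P : set (seq S) := [set s | s <> [::] /\ P s].

Lemma tree_iter_nonempty_nodes P a s :
  s <> [::] -> tree_iter P a s -> tree_iter (nonempty_nodes P) a s.
Proof.
elim: a s => [|a IH|u IH] //= s s0.
  move=> [sa [x xa]]; split; first exact: IH.
  by exists x; apply: IH => // /(congr1 size); rewrite size_rcons.
by move=> su n _; exact: IH (su n I).
Qed.

Lemma tree_iter_root P a h : tree_iter P h [::] -> olt a h ->
  tree_iter (nonempty_nodes P) a !=set0.
Proof.
move=> Ph ah.
have [_ [x xa]] := oiter_le tree_deriv_homo (@tree_deriv_sub S) ah Ph.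
by exists [:: x]; exact: tree_iter_nonempty_nodes.
Qed.

Lemma tree_iter_prefix P a s t : (forall s t, P (s ++ t) -> P s) ->
  tree_iter P a (s ++ t) -> tree_iter P a s.
Proof.
move=> Ppre; elim: a s t => [|a IH|u IH] /= s t; first exact: Ppre.
  move=> [st [x stx]]; split; first exact: IH st.
  case: t st stx => [|y t] st stx; first by exists x; rewrite cats0 in stx.
  by exists y; apply: (IH _ t); rewrite cat_rcons.
by move=> su n _; exact: IH (su n I).
Qed.

Lemma tree_iter_shift P a s :
  tree_iter [set t | P (s ++ t)] a = [set t | tree_iter P a (s ++ t)].
Proof.
elim: a => [|a IH|u IH] //; rewrite /tree_iter /= -?/(tree_iter _ _).
  rewrite IH; apply/seteqP; split=> t [/= ta [x xa]]; split=> //; exists x.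
    by rewrite rcons_cat.
  by rewrite /= -rcons_cat.
rewrite (eq_bigcapr (fun n _ => IH n)); apply/seteqP; split=> t tu n _; exact: tu.
Qed.

(** Otherwise every node of rank at least [h] could be extended to another one,
    and iterating this from the root would produce an infinite branch. *)
Lemma exact_rank_node P h :
  ~ (exists g : nat -> S, forall n, P (mkseq g n)) ->
  tree_iter P h [::] ->
  exists2 s, tree_iter P h s & ~ tree_iter P (osucc h) s.
Proof.
move=> noinf Ph; apply: contrapT => none.
have ext s : tree_iter P h s -> exists x, tree_iter P h (rcons s x).
  move=> sh; have [_ //] : tree_iter P (osucc h) s.
  by apply: contrapT => H; apply: none; exists s.
have [x0 _] := ext _ Ph.
have /choice[nx nxP] : forall s, exists x,
    tree_iter P h s -> tree_iter P h (rcons s x).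
  move=> s; have [/ext[x sx]|//] := pselect (tree_iter P h s); first by exists x.
  by exists x0.
pose br := fix br n := if n is m.+1 then rcons (br m) (nx (br m)) else [::].
apply: noinf; exists (nx \o br) => n.
suff [-> brP] : mkseq (nx \o br) n = br n /\ tree_iter P h (br n).
  exact: (oiter_sub (@tree_deriv_sub S)) brP.
elim: n => [|n [IH brP]] //; rewrite mkseqS IH; split=> //.
exact: nxP.
Qed.

(** A subtree of order [h] is the part of the tree above a node of rank
    exactly [h], which exists by well-foundedness. *)
Lemma subtree_of_order P h : (forall s t, P (s ++ t) -> P s) ->
  ~ (exists g : nat -> S, forall n, P (mkseq g n)) ->
  tree_iter P h [::] ->
  exists s, is_tree (nonempty_nodes [set t | P (s ++ t)]) /\
    oeq1 (tree_order (nonempty_nodes [set t | P (s ++ t)])) (Some h).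
Proof.
move=> Ppre noinf Ph.
have [s sh sNh] := exact_rank_node noinf Ph.
exists s; set Q := [set t | P (s ++ t)].
have Qpre t t' : Q (t ++ t') -> Q t by rewrite /Q /= catA; exact: Ppre.
split.
  by split=> [t []//|t t' t0 [_ tt']]; split=> //; exact: Qpre tt'.
apply: tree_order_eq => [a ah|].
  by apply: tree_iter_root ah; rewrite /Q tree_iter_shift /= cats0.
apply/seteqP; split=> [t th|t []//].
have [t0 _] : nonempty_nodes Q t := oiter_sub (@tree_deriv_sub S) th.
have {}th : tree_iter Q h t.
  by apply: (oiter_homo tree_deriv_homo (fun=> @subset_refl _ _)) th => u [].
case: t t0 th => // x t _ th; apply: sNh; split=> //; exists x.
have := @tree_iter_prefix Q h [:: x] t Qpre th.
by rewrite /Q tree_iter_shift /= cats1.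
Qed.

End TreeOrder.

(** * Oscillation sets and independent sequences *)

Section OscillationLetters.
Context {R : realType} {K : topologicalType} {cK : compact [set: K]}.
Context (f : nat -> @contfun R K cK).
Hypothesis f_ball : forall n, `|f n| <= 1.
Hypothesis f_cvg : forall k : K, cvgn (fun n => f n k : R).
Context (eps : R) (p : set_system nat) (pU : UltraFilter p).
Hypothesis p_infty : \oo `<=` p.
Context (C : finType) (thr : C -> R) (eta : R).
Hypothesis thr_cover : forall v, -1 <= v <= 1 ->
  exists c, thr c - 2 * eta <= v < thr c - eta.
Hypothesis eta_gt0 : 0 < eta.

Definition ptlim (k : K) : R := limn (fun n => f n k : R).

Lemma ptlim_near k (e : R) : 0 < e ->
  \forall n \near p, `|f n k - ptlim k| < e.
Proof.
move=> e0; apply: p_infty; have /cvgrPdist_lt/(_ e e0) := @f_cvg k.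
by apply: filterS => m; rewrite distrC.
Qed.

Lemma ptlim_bound k : `|ptlim k| <= 1.
Proof.
apply/ler_addgt0Pr => e e0; have [n /= nk] := filter_ex (ptlim_near k e0).
have := le_trans (supnorm_ub (f n) k) (f_ball n).
have := ler_normB (f n k : R) (f n k - ptlim k); rewrite subKr.
by move: nk; lra.
Qed.

(** A letter records the sign of the oscillation and an interval of length
    [eta] that contains the value of the limit. The threshold lies above this
    interval by a margin [eta], so that functions close to the limit stay below
    it, and at most [2 * eta] above the limit, so that an oscillation of size
    [eps] exceeds it by [eps - 2 * eta]. *)
Definition osc_letter (s : bool * C) (n : nat) : set K :=
  [set k | eps <= (-1) ^+ s.1 * (f n k - ptlim k) /\
           thr s.2 - 2 * eta <= (-1) ^+ s.1 * ptlim k < thr s.2 - eta].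

(** Asking for [p]-many indices makes the derivation finitely additive on closed
    sets, and still lets one index serve finitely many points at once. *)
Definition letter_deriv (s : bool * C) (A : set K) : set K :=
  [set x | A x /\ forall U : set K, nbhs x U ->
    p [set n | (osc_letter s n `&` A `&` U) !=set0]].

Lemma nbhs_pigeonhole (x : K) (I : finType) (Q : I -> nat -> set K) :
  (forall U, nbhs x U -> p [set n | exists i, (Q i n `&` U) !=set0]) ->
  exists i, forall U, nbhs x U -> p [set n | (Q i n `&` U) !=set0].
Proof.
move=> H; pose J := {U : set K | nbhs x U}.
have [||||i iP] := @directed_pigeonhole J
    (fun U V => projT1 V `<=` projT1 U) I
    (fun i U => p [set n | (Q i n `&` projT1 U) !=set0])
    (exist _ setT filterT).
- by move=> U V W UV VW; exact: subset_trans UV.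
- move=> [U xU] [V xV].
  by exists (exist _ (U `&` V) (filterI xU xV)) => y [].
- move=> i U V VU; apply: filterS => n [y [Qy Vy]].
  by exists y; split=> //; exact: VU.
- by move=> [U xU]; apply: ultrafilter_pigeonhole; exact: H.
by exists i => U xU; exact: (iP (exist _ U xU)).
Qed.

Lemma letter_deriv_homo s : {homo letter_deriv s : A B / A `<=` B}.
Proof.
move=> A B AB x [Ax H]; split=> [|U /H]; first exact: AB.
by apply: filterS => n [y [[ny Ay] Uy]]; exists y; split=> //; split=> //; exact: AB.
Qed.

Lemma letter_deriv_sub s A : letter_deriv s A `<=` A.
Proof. by move=> x []. Qed.

Lemma letter_deriv_closed s A : closed A -> closed (letter_deriv s A).
Proof.
move=> cA x clx; split.
  by apply: cA => U /clx[y [[Ay _] Uy]]; exists y.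
move=> U; rewrite nbhsE => -[V [oV Vx] VU].
have [y [[_ yP] Vy]] := clx V (open_nbhs_nbhs (conj oV Vx)).
apply: filterS (yP V (open_nbhs_nbhs (conj oV Vy))) => n [z [nz Vz]].
by exists z; split=> //; exact: VU.
Qed.

Lemma letter_deriv_additive s (I : finType) (A : I -> set K) :
  (forall i, closed (A i)) ->
  letter_deriv s (\bigcup_i A i) `<=` \bigcup_i letter_deriv s (A i).
Proof.
move=> cA x [_ xP].
have [|i iP] := @nbhs_pigeonhole x I (fun i n => osc_letter s n `&` A i).
  move=> U /xP; apply: filterS => n [y [[ny [i _ Ay]] Uy]].
  by exists i, y.
exists i => //; split=> //; apply: cA => U /iP/filter_ex[n [y [[_ Ay] Uy]]].
by exists y.
Qed.

Lemma osc_set_letters a :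
  osc_set eps (fun n => f n : K -> R) a `<=`
  oiter (union_deriv letter_deriv) [set: K] a.
Proof.
elim: a => [|a IH|u IH] //=; last by move=> x xu n _; exact: IH (xu n I).
move=> x [xa xP]; set A := oiter _ _ a in IH *.
have [|s sP] := @nbhs_pigeonhole x (bool * C)%type
    (fun s n => osc_letter s n `&` A).
  move=> U /xP[N NP]; apply: p_infty; exists N => // n /= Nn.
  have [M MP] := NP n Nn.
  have found (b : bool) (y : K) : A y -> U y ->
      (forall m, (M <= m)%N -> eps < (-1) ^+ b * ((f n y : R) - f m y)) ->
      exists s, (osc_letter s n `&` A `&` U) !=set0.
    move=> Ay Uy yM.
    have [|c yc] := @thr_cover ((-1) ^+ b * ptlim y).
      by rewrite -ler_norml normrMsign ptlim_bound.
    exists (b, c), y; split=> //; split=> //; split=> //=.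
    apply/ler_addgt0Pl => e e0.
    have Mp : p [set m | (M <= m)%N] by apply: p_infty; exists M.
    have [m [/yM Mm my]] := filter_ex (filterI Mp (ptlim_near y e0)).
    have : `|(-1) ^+ b * ((f m y : R) - ptlim y)| < e by rewrite normrMsign.
    rewrite ltr_norml => /andP[+ _]; move: Mm.
    by rewrite !mulr_sign; case: (b) => /=; lra.
  case: MP => -[z [[zM /IH Az] Uz]].
    by apply: (found false z) => // m Mm; rewrite expr0 mul1r; exact: zM.
  by apply: (found true z) => // m Mm; rewrite expr1 mulN1r ltrNr; exact: zM.
by exists s => //; split=> //; exact: IH.
Qed.

(** The low points [y] come from an index [m] fixed first and the high points [z]
    from an index [n] so large that [f n] is close to the limit at all the
    [y]. Both are oscillation points of the same letter, so the limit takes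
    nearly the same value at all of them. *)
Lemma independent_on_extend (b : bool) (c : C) (d : R) (A : set K)
    (s : seq (@contfun R K cK)) : d + 2 * eta < eps ->
  independent_on thr b d (letter_deriv (b, c) A) s ->
  exists n, independent_on thr b d A (rcons s (f n)).
Proof.
move=> d_eps [col colP].
pose U (t : (size s).-tuple bool) : set K :=
  [set k | forall l : 'I_(size s), separated thr b d (col l) s`_l (tnth t l) k].
have pU_meet t : p [set n | (osc_letter (b, c) n `&` A `&` U t) !=set0].
  have [k [_ kP] ks] := colP (nth false t).
  apply: kP; apply: (@filter_forall K _
    (fun l : 'I_(size s) => separated thr b d (col l) s`_l (tnth t l))) => l.
  apply: open_nbhs_nbhs; split; first exact: open_separated.
  by rewrite (tnth_nth false); exact: ks.
have pF : Filter p by exact: _.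
have all_meet := filter_forall pF pU_meet.
have [m /choice[y yP]] := filter_ex all_meet.
have near_y := filter_forall pF (fun t => ptlim_near (y t) eta_gt0).
have [n [/= /choice[z zP] nP]] := filter_ex (filterI all_meet near_y).
(* The new function gets the threshold of the letter. *)
exists n, (fun l => if (l < size s)%N then col l else c) => J.
pose t : (size s).-tuple bool := [tuple J l | l < size s].
exists (if J (size s) then z t else y t).
  by case: (J _); [have [[]] := zP t|have [[]] := yP t].
move=> l; rewrite size_rcons ltnS leq_eqVlt nth_rcons => /orP[/eqP ->|ls].
  rewrite ltnn eqxx /separated; case: (J _).
    by have [[[/= lo /andP[hi _]] _] _] := zP t; move: lo hi; rewrite !mulrBr; lra.
  have [[[/= _ /andP[_ hi]] _] _] := yP t.
  have := nP t; have : `|(-1) ^+ b * ((f n (y t) : R) - ptlim (y t))| =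
    `|(f n (y t) : R) - ptlim (y t)| by rewrite normrMsign.
  by move=> <-; rewrite ltr_norml => /andP[_]; move: hi; rewrite !mulr_sign; case: (b) => /=; lra.
rewrite ls; have := tnth_mktuple (fun l => J (val l)) (Ordinal ls) => /= <-.
by case: (J _); [have [_] := zP t|have [_] := yP t]; exact.
Qed.

End OscillationLetters.

(** * Ranks in the tree of independent sequences *)

Section IndependentTree.
Context {R : realType} {K : topologicalType} {cK : compact [set: K]}.
Context (f : nat -> @contfun R K cK).

Definition independent_tree (C : finType) (thr : C -> R) (b : bool) (d : R) :
    set (seq (@contfun R K cK)) :=
  [set s | (forall x, x \in s -> exists n, x = f n) /\
           independent_on thr b d [set: K] s].

Section Ranks.
Hypothesis f_ball : forall n, `|f n| <= 1.
Hypothesis f_cvg : forall k : K, cvgn (fun n => f n k : R).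
Context (eps : R) (p : set_system nat) (pU : UltraFilter p).
Hypothesis p_infty : \oo `<=` p.
Context (C : finType) (thr : C -> R) (eta d : R).
Hypothesis eta_gt0 : 0 < eta.
Hypothesis d_eps : d + 2 * eta < eps.
Let D := letter_deriv f eps p thr eta.

(** Each application of the derivation pays for one extension of the sequence. *)
Lemma tree_iter_letter b c (B : set K) (a0 a : ord)
    (T := independent_tree thr b d) :
  (forall s, T s -> independent_on thr b d B s -> tree_iter T a0 s) ->
  forall s, T s -> independent_on thr b d (oiter (D (b, c)) B a) s ->
    tree_iter T (oadd a0 a) s.
Proof.
move=> base; elim: a => [|a IH|u IH] s Ts //=; first exact: base.
  move=> sa; split; first by apply: IH (independent_on_sub _ sa) => // x [].
  have [n na] := independent_on_extend f_cvg pU p_infty eta_gt0 d_eps sa.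
  exists (f n); apply: (IH (rcons s (f n))) => //.
  split; last exact: independent_on_sub na.
  by move=> x; rewrite mem_rcons in_cons => /orP[/eqP->|/Ts.1//]; exists n.
by move=> su n _; apply: IH => //; apply: independent_on_sub su => x /(_ n I).
Qed.

(** The recursion [omuln a k.+1 = oadd (omuln a k) a] matches the descent along a
    word: the first block is the outermost one, and its [a] derivatives are
    counted on top of those of the remaining blocks. *)
Lemma tree_iter_word b a (w : seq (bool * C)) (T := independent_tree thr b d) :
  all (fun l => l.1 == b) w ->
  forall s, T s -> independent_on thr b d (word_deriv D a [set: K] w) s ->
    tree_iter T (omuln a (size w)) s.
Proof.
elim: w => [//|[b' c] w IH] /= /andP[/eqP-> /IH wb] s Ts ws.
exact: tree_iter_letter ws.
Qed.

End Ranks.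

(** This is the only place where the ordinal is halved: independence needs
    oscillations of one sign, and one of the two signs is the more frequent. *)
Lemma majority_subword (C : finType) (w : seq (bool * C)) : exists b u,
  [/\ subseq u w, size u = (size w).+1./2 & all (fun l => l.1 == b) u].
Proof.
have [b bP] : exists b,
    ((size w).+1./2 <= size [seq l <- w | l.1 == b])%N.
  have : size w = (size [seq l <- w | l.1 == true] +
                   size [seq l <- w | l.1 == false])%N.
    rewrite !size_filter -(count_predC (fun l => l.1 == true) w); congr addn.
    by apply: eq_count => -[[] c].
  case: (leqP (size w).+1./2 (size [seq l <- w | l.1 == true])) => [|lt E].
    by exists true.
  by exists false; move: lt E; set m := size _; set n := size _; lia.
exists b, (take (size w).+1./2 [seq l <- w | l.1 == b]); split.
- exact: subseq_trans (take_subseq _ _) (filter_subseq _ _).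
- by rewrite size_takel.
- apply/allP => l /(mem_subseq (take_subseq _ _)).
  by rewrite mem_filter => /andP[].
Qed.

Lemma interval_cover (eta : R) : 0 < eta -> exists (C : finType) (thr : C -> R),
  forall v, -1 <= v <= 1 -> exists c, thr c - 2 * eta <= v < thr c - eta.
Proof.
move=> eta0; pose N := Num.truncn (2 / eta).
exists 'I_N.+1, (fun c : 'I_N.+1 => -1 + (c%:R + 2) * eta) => v /andP[v1 v2].
have q0 : 0 <= (v + 1) / eta by rewrite divr_ge0//; lra.
have cN : (Num.truncn ((v + 1) / eta) < N.+1)%N.
  by rewrite ltnS le_truncn// ler_wpM2r ?invr_ge0 ?(ltW eta0)//; lra.
exists (Ordinal cN) => /=.
have /andP[] := truncn_itv q0; rewrite ler_pdivlMr// ltr_pdivrMr//.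
by rewrite -[in X in _ -> X -> _]natr1 => lo hi; apply/andP; split; lra.
Qed.

Lemma independent_tree_rank (f_ball : forall n, `|f n| <= 1)
    (f_cvg : forall k : K, cvgn (fun n => f n k : R))
    (eps d : R) (alpha : ord) : d < eps ->
  osc_set eps (fun n => f n : K -> R) alpha !=set0 ->
  exists (C : finType) (thr : C -> R) b,
    tree_iter (independent_tree thr b d) (ord_half alpha) [::].
Proof.
move=> d_eps [x xa]; rewrite /ord_half; case: cid => /= h.
move=> [g [k [r [[[_ alpha_ge] _ _] ->]]]].
have [p [pU p_infty]] := @ultraFilterLemma nat \oo _.
pose eta := (eps - d) / 4.
have eta0 : 0 < eta by rewrite divr_gt0//; lra.
have [C [thr thr_cover]] := interval_cover eta0; exists C, thr.
pose D := letter_deriv f eps p thr eta.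
have D_homo s : {homo D s : A B / A `<=` B} by exact: letter_deriv_homo.
have D_sub s A : D s A `<=` A by exact: letter_deriv_sub.
have D_closed s A : closed A -> closed (D s A) by exact: letter_deriv_closed.
have D_add s (J : finType) (A : J -> set K) : (forall i, closed (A i)) ->
  D s (\bigcup_i A i) `<=` \bigcup_i D s (A i) by exact: letter_deriv_additive.
have xD := osc_set_letters f_ball f_cvg pU p_infty thr_cover xa.
have {xD} := oiter_le (union_deriv_homo D_homo) (union_deriv_sub D_sub)
  (ole_trans (ole_add _ _) alpha_ge) xD.
have hom := homogeneous_omega_pow D_homo D_sub D_closed D_add (g := g).
move=> /(oiter_omuln_word D_homo D_sub D_closed D_add hom closedT)[w _ wx].
have [b [u [uw sz_u ub]]] := majority_subword w.
exists b; rewrite -(size_tuple w) -sz_u.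
have d_eta : d + 2 * eta < eps by rewrite /eta; lra.
apply: (tree_iter_word f_cvg pU p_infty eta0 d_eta (a := omega_pow g) ub).
  split=> //; case: (thr_cover 0) => [|c _]; first lra.
  by exists (fun=> c) => J; exists x.
case: (thr_cover 0) => [|c _]; first lra.
by exists (fun=> c) => J; exists x => //; exact: word_deriv_subseq wx.
Qed.

Lemma mem_closed_span n : closed_span f (f n).
Proof.
apply: subset_closure; exists n.+1, (fun i => (i == ord_max)%:R).
rewrite big_ord_recr /= eqxx scale1r big1 ?add0r// => i _.
by rewrite -val_eqE /= ltn_eqF ?scale0r// ltn_ord.
Qed.

Lemma independent_tree_ell1 (f_ball : forall n, `|f n| <= 1)
    (C : finType) (thr : C -> R) b d s : s <> [::] ->
  independent_tree thr b d s -> ell1_tree (closed_span f) (d / 2) s.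
Proof.
move=> s0 [sf ind]; split=> //; last by move=> l; exact: independent_on_l1 ind.
by move=> x /sf[n ->]; split; [exact: mem_closed_span|exact: f_ball].
Qed.

End IndependentTree.

Theorem theorem3p1 (R : realType) (K : metricType R) (cK : compact [set: K])
    (f : nat -> contfun cK) (f_ball : forall n, `|f n| <= 1)
    (f_cvg : forall k : K, cvgn (fun n => f n k : R))
    (eps : R) (eps_gt0 : 0 < eps) (alpha : ord) :
  osc_set eps (fun n => f n : K -> R) alpha !=set0 ->
  (forall eps' : R, 0 < eps' < eps ->
    ole1 (Some (ord_half alpha)) (ell (closed_span f) (eps' / 2))) /\
  (exists T : set (seq (contfun cK)),
    ell1_index_tree_on f T /\
    oeq1 (tree_order T) (Some (ord_half alpha))).
Proof.
move=> osc; split=> [eps' /andP[_ eps'_lt]|].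
  have [C [thr [b rk]]] := independent_tree_rank f_ball f_cvg eps'_lt osc.
  apply: tree_order_ge => a ah.
  have [s sa] := tree_iter_root rk ah; exists s; move: s sa.
  apply: (oiter_homo tree_deriv_homo (fun=> @subset_refl _ _)) => s [s0 Ps].
  exact: independent_tree_ell1 Ps.
(* Any separation constant strictly between 0 and eps would do here. *)
have d0 : 0 < eps / 2 by rewrite divr_gt0.
have d_lt : eps / 2 < eps by lra.
have [C [thr [b rk]]] := independent_tree_rank f_ball f_cvg d_lt osc.
have [|[g gP]|s [sT sord]] := subtree_of_order _ _ rk.
- move=> s t [st_f st_ind]; split; last exact: independent_on_catl st_ind.
  by move=> x xs; apply: st_f; rewrite mem_cat xs.
- apply: (no_independent_subsequence d0 f_cvg) (fun n => (gP n).2) => i.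
  by apply: (gP i.+1).1; rewrite mkseqS mem_rcons mem_head.
have tP t : independent_tree f thr b (eps / 2) (s ++ t) ->
    independent_tree f thr b (eps / 2) t.
  move=> [st_f st_ind]; split; last exact: independent_on_catr st_ind.
  by move=> x xt; apply: st_f; rewrite mem_cat xt orbT.
eexists; split; last exact: sord; split=> //.
- exists (eps / 2 / 2); first by rewrite divr_gt0.
  by move=> t [t0 /tP Pt]; exact: independent_tree_ell1 Pt.
- by move=> t [_ /tP[tf _]]; exact: tf.
Qed.
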